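(* Let $U$ be an $N$-qubit unitary admitting an LME state $|\phi_U\rangle\in(\mathbb C^2)^{\otimes N}$, i.e. such that there exist isometries $V_k:\mathbb C^2\to\mathbb C^2_{A_k}\otimes\mathbb C^2_{B_k}$ ($V_k^\dagger V_k=\mathbb 1$, $k=1,\dots,N$) and a vector $|\phi_U\rangle\in(\mathbb C^2)^{\otimes N}$ with $|U\rangle_{AB}=\bigotimes_kV_k|\phi_U\rangle$. Then $U$ is LU-equivalent to a phase unitary, i.e. to a unitary of the form $$U_{\rm phase}=\sum_{i_1,\dots,i_N\in\{0,1\}}e^{i\theta_{i_1\dots i_N}}|i_1\dots i_N\rangle\langle i_1\dots i_N|,\qquad \theta_{i_1\dots i_N}\in\mathbb R .$$
   Context: For a unitary $U$ on $(\mathbb C^2)^{\otimes N}$, its vectorization is $|U\rangle_{AB}=\sum_{ij}U_{ij}|i\rangle_A|j\rangle_B$, where $i,j$ run over the computational product basis, $A=A_1\cdots A_N$, $B=B_1\cdots B_N$, and $A_k,B_k$ are the two qubits (one from the output and one from the input of $U$) associated with site $k$. In $\bigotimes_kV_k|\phi_U\rangle$ the isometry $V_k$ maps the $k$-th qubit of $|\phi_U\rangle$ to the pair $A_kB_k$. LU-equivalence (local-unitary equivalence) of two $N$-qubit unitaries $U,U'$ means $U'=(\bigotimes_kX_k)\,U\,(\bigotimes_kY_k)$ for some single-qubit unitaries $X_k,Y_k$. *)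

(* Defs.v *)
From HB Require Import structures.
From mathcomp Require Import all_boot all_order all_algebra.
From mathcomp Require Export spectral.
From mathcomp Require Export complex.
From mathcomp Require Export reals trigo.
Set Implicit Arguments.
Unset Strict Implicit.
Unset Printing Implicit Defensive.
Import Order.TTheory GRing.Theory Num.Theory.
Local Open Scope ring_scope.
Local Open Scope sesquilinear_scope.

(* Labels of the product basis of (C^d)^{(x)N}: one digit per site. *)
Definition label (N d : nat) := {ffun 'I_N -> 'I_d}.

(* Vectors and operators on (C^d)^{(x)N} are matrices whose indices enumerate
   the product basis through enum_rank / enum_val. *)
Definition tdim (N d : nat) : nat := #|{ffun 'I_N -> 'I_d}|.

Definition ket (R : realType) (N d : nat) (f : label N d) : 'cV[R[i]]_(tdim N d) :=
  delta_mx (enum_rank f) 0.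

(* U_{ij} = <i|U|j> for product-basis labels i, j. *)
Definition entry (R : realType) (N d : nat) (U : 'M[R[i]]_(tdim N d))
    (i j : label N d) : R[i] :=
  U (enum_rank i) (enum_rank j).

Definition tensor (R : realType) (N m n : nat) (X : 'I_N -> 'M[R[i]]_(m, n)) :
    'M[R[i]]_(tdim N m, tdim N n) :=
  \matrix_(p, q) \prod_(k < N)
     X k ((enum_val p : label N m) k) ((enum_val q : label N n) k).

(* |i>_A |j>_B with the factors regrouped site by site: the two qubits A_k B_k
   form a single factor C^2 (x) C^2 = C^(2*2), in which |a>|b> is the basis
   vector of index mxvec_index a b. *)
Definition site_pairs (N : nat) (i j : label N 2) : label N (2 * 2) :=
  [ffun k => mxvec_index (i k) (j k)].

Definition vectorization (R : realType) (N : nat) (U : 'M[R[i]]_(tdim N 2)) :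
    'cV[R[i]]_(tdim N (2 * 2)) :=
  \sum_(i : label N 2) \sum_(j : label N 2)
     entry U i j *: ket R (site_pairs i j).

(* MathComp's unitarymx says V *m V^t* = 1, which for a rectangular V is the
   coisometry condition, hence the separate notion. *)
Definition isometry_mx (R : realType) (m n : nat) (V : 'M[R[i]]_(m, n)) : Prop :=
  V^t* *m V = 1%:M.

Definition admits_LME_state (R : realType) (N : nat)
    (U : 'M[R[i]]_(tdim N 2)) : Prop :=
  exists (V : 'I_N -> 'M[R[i]]_(2 * 2, 2)) (phi : 'cV[R[i]]_(tdim N 2)),
    (forall k, isometry_mx (V k)) /\ vectorization U = tensor V *m phi.

Definition LU_equivalent (R : realType) (N : nat)
    (U U' : 'M[R[i]]_(tdim N 2)) : Prop :=
  exists X Y : 'I_N -> 'M[R[i]]_2,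
    [/\ forall k, X k \is unitarymx,
        forall k, Y k \is unitarymx &
        U' = tensor X *m U *m tensor Y].

(* e^{i t} *)
Definition expi (R : realType) (t : R) : R[i] := (cos t +i* sin t)%C.

Definition phase_unitary (R : realType) (N : nat) (theta : label N 2 -> R) :
    'M[R[i]]_(tdim N 2) :=
  \sum_(i : label N 2) expi (theta i) *: (ket R i *m (ket R i)^t*).

(* Main.v *)
(* Fix a site k.  The LME hypothesis gives U = P (x) A + Q (x) B with P, Q acting
   on site k and A, B on the other sites.  The pencil of P and Q contains a
   singular matrix, so after recombination and local unitaries P is a multiple of
   |1><1|.  Comparing the 2x2 blocks of U^dagger U = 1 and U U^dagger = 1 then
   leaves two cases: either the off-diagonal entries of Q vanish, or every block
   of U is a multiple of B, so that U = w (x) B with w proportional to a unitary.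
   In both cases unitaries at site k alone make U diagonal at site k.  Doing this
   at every site yields a diagonal unitary. *)
From HB Require Import structures.
Require Import Defs.
From mathcomp Require Import all_boot all_order all_algebra.
From mathcomp Require Import ring lra boolp.
Set Implicit Arguments.
Unset Strict Implicit.
Unset Printing Implicit Defensive.
Import Order.TTheory GRing.Theory Num.Theory.
Local Open Scope ring_scope.
Local Open Scope sesquilinear_scope.

(** * Product operators and operators acting on one site *)

Section Tensor.
Variables (R : realType) (N : nat).
Local Notation C := R[i].

Lemma tensorM m n p (X : 'I_N -> 'M[C]_(m, n)) (Y : 'I_N -> 'M[C]_(n, p)) :
  tensor X *m tensor Y = tensor (fun k => X k *m Y k).
Proof.
apply/matrixP => a b; rewrite !mxE.
under [RHS]eq_bigr do rewrite mxE.
rewrite bigA_distr_bigA /=.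
rewrite (reindex (enum_val : 'I_(tdim N n) -> label N n)) /=; last first.
  by exists enum_rank => x _; [exact: enum_valK | exact: enum_rankK].
by apply: eq_bigr => c _; rewrite !mxE big_split.
Qed.

Lemma tensor1 d : tensor (fun=> 1%:M) = 1%:M :> 'M[C]_(tdim N d).
Proof.
apply/matrixP => a b; rewrite !mxE.
case: eqP => [-> | /eqP neq_ab].
  by rewrite big1 // => k _; rewrite mxE eqxx.
have [k nk|eq_ab] := pickP (fun k =>
    (enum_val a : label N d) k != (enum_val b : label N d) k).
  by rewrite (bigD1 k) //= mxE (negbTE nk) mul0r.
case/eqP: neq_ab; apply: enum_val_inj; apply/ffunP => k.
by apply/eqP/negbFE/eq_ab.
Qed.

Lemma tensor_adj m n (X : 'I_N -> 'M[C]_(m, n)) :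
  (tensor X)^t* = tensor (fun k => (X k)^t*).
Proof.
apply/matrixP => a b; rewrite !mxE rmorph_prod.
by apply: eq_bigr => k _; rewrite !mxE.
Qed.

Lemma eq_tensor m n (X Y : 'I_N -> 'M[C]_(m, n)) :
  X =1 Y -> tensor X = tensor Y.
Proof.
move=> eqXY; apply/matrixP => a b; rewrite !mxE.
by apply: eq_bigr => k _; rewrite eqXY.
Qed.

Lemma tensor_unitary d (X : 'I_N -> 'M[C]_d) :
  (forall k, X k \is unitarymx) -> tensor X \is unitarymx.
Proof.
move=> unitX; apply/unitarymxP; rewrite tensor_adj tensorM -tensor1.
by apply: eq_tensor => k; apply/unitarymxP.
Qed.

Definition site (d : nat) (k : 'I_N) (M : 'M[C]_d) : 'M[C]_(tdim N d) :=
  tensor (fun l => if l == k then M else 1%:M).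

Lemma siteE d k (M : 'M[C]_d) p q : site k M p q =
  M ((enum_val p : label N d) k) ((enum_val q : label N d) k) *
  \prod_(l < N | l != k)
     ((enum_val p : label N d) l == (enum_val q : label N d) l)%:R.
Proof.
rewrite mxE (bigD1 k) //= eqxx; congr (_ * _).
by apply: eq_bigr => l /negbTE->; rewrite mxE.
Qed.

Lemma site_is_linear d k : linear (@site d k).
Proof.
by move=> s A B; apply/matrixP => p q; rewrite siteE 4!mxE !siteE mulrDl -mulrA.
Qed.

HB.instance Definition _ d k := GRing.isLinear.Build C 'M[C]_d 'M[C]_(tdim N d) _
  (@site d k) (@site_is_linear d k).

Lemma siteM d k (A B : 'M[C]_d) : site k (A *m B) = site k A *m site k B.
Proof.
by rewrite tensorM; apply: eq_tensor => l; case: eqP => // _; rewrite mulmx1.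
Qed.

Lemma site1 d k : site k (1%:M : 'M[C]_d) = 1%:M.
Proof. by rewrite -tensor1; apply: eq_tensor => l; case: eqP. Qed.

Lemma site_adj d k (A : 'M[C]_d) : site k (A^t*) = (site k A)^t*.
Proof.
rewrite tensor_adj; apply: eq_tensor => l; case: eqP => // _.
by rewrite trmx1 map_mx1.
Qed.

(* F acts trivially on site k: instead of a tensor factor on N - 1 sites we use an
   N-site matrix in the commutant of the operators on site k. *)
Definition off_site d k (F : 'M[C]_(tdim N d)) :=
  forall M : 'M[C]_d, site k M *m F = F *m site k M.

Definition drop_site d k (X : 'I_N -> 'M[C]_d) : 'I_N -> 'M[C]_d :=
  fun l => if l == k then 1%:M else X l.

Lemma off_site_tensor d k (X : 'I_N -> 'M[C]_d) : off_site k (tensor (drop_site k X)).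
Proof.
move=> M; rewrite /site !tensorM; apply: eq_tensor => l; rewrite /drop_site.
by case: eqP; rewrite mulmx1 mul1mx.
Qed.

Lemma tensor_site d k (X : 'I_N -> 'M[C]_d) :
  tensor X = site k (X k) *m tensor (drop_site k X).
Proof.
rewrite /site tensorM; apply: eq_tensor => l; rewrite /drop_site.
by case: eqP => [->|_]; rewrite ?mulmx1 ?mul1mx.
Qed.

(** * The commutant of one site and block decompositions over it *)

Section Commutant.
Variables (d : nat) (k : 'I_N).

Lemma off_site_adj (F : 'M[C]_(tdim N d)) : off_site k F -> off_site k (F^t*).
Proof.
move=> cF M; have := cF (M^t*); move/(congr1 (fun A => A^t*)).
by rewrite !trmx_mul !map_mxM -!site_adj trmxCK => ->.
Qed.

Lemma off_siteM (F G : 'M[C]_(tdim N d)) : off_site k F -> off_site k G -> off_site k (F *m G).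
Proof. by move=> cF cG M; rewrite mulmxA cF -!mulmxA cG. Qed.

Lemma off_siteD (F G : 'M[C]_(tdim N d)) : off_site k F -> off_site k G -> off_site k (F + G).
Proof. by move=> cF cG M; rewrite mulmxDr mulmxDl cF cG. Qed.

Lemma off_siteZ (s : C) (F : 'M[C]_(tdim N d)) : off_site k F -> off_site k (s *: F).
Proof. by move=> cF M; rewrite -scalemxAr -scalemxAl cF. Qed.

Lemma off_site0 : off_site k (0 : 'M[C]_(tdim N d)).
Proof. by move=> M; rewrite mulmx0 mul0mx. Qed.

Lemma off_site1 : off_site k (1%:M : 'M[C]_(tdim N d)).
Proof. by move=> M; rewrite mulmx1 mul1mx. Qed.

Lemma off_site_sum (I : finType) (P : pred I) (F : I -> 'M[C]_(tdim N d)) :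
  (forall i, off_site k (F i)) -> off_site k (\sum_(i | P i) F i).
Proof.
by move=> cF; elim/big_ind: _ => //; [exact: off_site0 | exact: off_siteD].
Qed.

(** For [F a b] in the commutant of site [k] this is the sum of |a><b| (x) [F a b], a block matrix
    whose entries are operators on the other sites. *)
Definition blocks (F : 'I_d -> 'I_d -> 'M[C]_(tdim N d)) :=
  \sum_a \sum_b site k (delta_mx a b) *m F a b.

Lemma blocks_mul (F G : 'I_d -> 'I_d -> 'M[C]_(tdim N d)) :
  (forall a b, off_site k (F a b)) ->
  blocks F *m blocks G = blocks (fun a b => \sum_c F a c *m G c b).
Proof.
move=> cF; rewrite /blocks mulmx_suml; apply: eq_bigr => a _.
under [RHS]eq_bigr do rewrite mulmx_sumr.
rewrite [RHS]exchange_big mulmx_suml; apply: eq_bigr => c _ /=.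
rewrite mulmx_sumr (bigD1 c) //= [X in _ + X]big1 ?addr0 => [|c' neq]; rewrite mulmx_sumr.
  apply: eq_bigr => b _; rewrite mulmxA -(mulmxA (site _ _)) -cF !mulmxA.
  by rewrite -siteM mul_delta_mx.
rewrite big1 // => b _; rewrite mulmxA -(mulmxA (site _ _)) -cF !mulmxA.
by rewrite -siteM mul_delta_mx_0 ?linear0 ?mul0mx // eq_sym.
Qed.

Lemma blocks_adj (F : 'I_d -> 'I_d -> 'M[C]_(tdim N d)) :
  (forall a b, off_site k (F a b)) ->
  (blocks F)^t* = blocks (fun a b => (F b a)^t*).
Proof.
move=> cF; rewrite /blocks exchange_big /= linear_sum map_mx_sum /=; apply: eq_bigr => a _.
rewrite linear_sum map_mx_sum /=; apply: eq_bigr => b _.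
rewrite trmx_mul map_mxM -site_adj -(off_site_adj (cF b a)).
by rewrite trmx_delta map_delta_mx.
Qed.

Lemma blocks_site (M : 'M[C]_d) F : blocks (fun a b => M a b *: F) = site k M *m F.
Proof.
rewrite [in RHS](matrix_sum_delta M) linear_sum mulmx_suml; apply: eq_bigr => a _.
rewrite linear_sum mulmx_suml; apply: eq_bigr => b _.
by rewrite -scalemxAr [in RHS]linearZ -scalemxAl.
Qed.

Lemma blocks_inj (F G : 'I_d -> 'I_d -> 'M[C]_(tdim N d)) :
  (forall a b, off_site k (F a b)) -> (forall a b, off_site k (G a b)) ->
  blocks F = blocks G -> F =2 G.
Proof.
(* Compressing by matrix units recovers a block: the sum over [c] of |c><a| [blocks H] |b><c| is 1
   (x) [H a b]. *)
suff blocksK H a b : (forall a b, off_site k (H a b)) ->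
    \sum_c site k (delta_mx c a) *m blocks H *m site k (delta_mx b c) = H a b.
  by move=> cF cG eqFG a b; rewrite -(blocksK F) // eqFG blocksK.
move=> cH; transitivity (\sum_c site k (delta_mx c c) *m H a b); last first.
  by rewrite -mulmx_suml -linear_sum /= -mx1_sum_delta site1 mul1mx.
apply: eq_bigr => c _; rewrite mulmx_sumr mulmx_suml (bigD1 a) //=.
rewrite [X in _ + X]big1 ?addr0 => [|a' neq]; rewrite mulmx_sumr mulmx_suml.
  rewrite (bigD1 b) //= [X in _ + X]big1 ?addr0 => [|b' neq].
    by rewrite -mulmxA -[X in _ *m X]mulmxA -cH !mulmxA -!siteM !mul_delta_mx.
  rewrite -mulmxA -[X in _ *m X]mulmxA -cH !mulmxA -!siteM !mul_delta_mx.
  by rewrite mul_delta_mx_0 ?linear0 ?mul0mx.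
rewrite big1 // => b' _; rewrite !mulmxA -siteM mul_delta_mx_0 1?eq_sym //.
by rewrite linear0 !mul0mx.
Qed.

Lemma site_inj_scalar (M : 'M[C]_d) (s : C) : (0 < tdim N d)%N ->
  site k M = s%:M -> M = s%:M.
Proof.
move=> n_gt0 eqM.
have : blocks (fun a b => M a b *: 1%:M) = blocks (fun a b => (s%:M : 'M_d) a b *: 1%:M).
  rewrite !blocks_site !mulmx1 eqM.
  by rewrite -[s%:M in RHS]scalemx1 linearZ /= site1 scalemx1.
move/blocks_inj => eqb; apply/matrixP => a b.
have /matrixP/(_ (Ordinal n_gt0) (Ordinal n_gt0)) :=
  eqb (fun a b => off_siteZ _ off_site1) (fun a b => off_siteZ _ off_site1) a b.
by rewrite !mxE eqxx !mulr1.
Qed.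

End Commutant.
End Tensor.
Lemma sum_ord2 (V : nmodType) (f : 'I_2 -> V) : \sum_a f a = f 0 + f 1.
Proof. by rewrite big_ord_recl big_ord1; congr (_ + f _); apply: val_inj. Qed.

(** * Singular 2x2 matrices, matrix pencils and complex phases *)

Section Matrices.
Variable R : realType.
Local Notation C := R[i].

Lemma unitary_row0 n (u : 'rV[C]_n.+1) :
  exists2 X : 'M_n.+1, X \is unitarymx & (u <= row 0 X)%MS.
Proof.
(* Gram-Schmidt completes even this rank-one matrix, all of whose rows are [u], to a unitary, and
   its first row spans [u]. *)
exists (schmidt (\matrix_(i < n.+1) u)); first exact: schmidt_unitarymx.
have := row_schmidt_sub (\matrix_(i < n.+1) u) 0.
rewrite rowK => /submx_trans; apply; apply/sumsmx_subP => i.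
rewrite leqn0 => /eqP i0; have -> : i = 0 by apply: val_inj.
by rewrite genmxE.
Qed.

(** A nonzero left kernel vector of [P], once normalized, serves as the first row of [X]. *)
Lemma unitary_kill_row0 n (P : 'M[C]_n.+1) : \det P = 0 ->
  exists2 X : 'M_n.+1, X \is unitarymx & row 0 (X *m P) = 0.
Proof.
move/eqP/det0P => [u u_neq0 uP0].
have [X unitX /submxP [s def_u]] := unitary_row0 u.
exists X => //; rewrite row_mul.
have s_neq0 : s 0 0 != 0.
  apply: contraNneq u_neq0 => s0; rewrite def_u [s]mx11_scalar s0.
  by rewrite raddf0 mul0mx.
apply: (scalerI s_neq0); rewrite scaler0 scalemxAl.
by rewrite -mul_scalar_mx -mx11_scalar -def_u.
Qed.

Lemma singular_corner (P : 'M[C]_2) : \det P = 0 ->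
  exists X Y : 'M[C]_2, exists s,
    [/\ X \is unitarymx, Y \is unitarymx & X *m P *m Y = s *: delta_mx 1 1].
Proof.
move=> detP; have [X unitX XP0] := unitary_kill_row0 detP.
(* Killing row 0 of the adjoint amounts to killing column 0 of [P], so the adjoint of this [Y] is
   the right-hand unitary. With row 0 and column 0 gone, only the (1, 1) entry survives. *)
have [|Y unitY YP0] := @unitary_kill_row0 _ (P^t*).
  by rewrite det_map_mx det_tr detP rmorph0.
exists X, (Y^t*), ((X *m P *m Y^t*) 1 1).
split; rewrite ?trmxC_unitary //.
have PY0 : col 0 (P *m Y^t*) = 0.
  apply/colP => i; move/rowP/(_ i)/(congr1 Num.conj): YP0.
  rewrite !mxE conjC0 rmorph_sum => {2}<-; apply: eq_bigr => j _.
  by rewrite !mxE rmorphM /= conjCK mulrC.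
apply/matrixP => a b; rewrite [RHS]mxE [X in _ * X]mxE.
have [->|a1] /= := eqVneq a 1; last first.
  have -> : a = 0 by case: a a1 => [[|[|[]]]] // lt _; apply: val_inj.
  rewrite mulr0; transitivity ((row 0 (X *m P) *m Y^t*) 0 b).
    by rewrite -row_mul [RHS]mxE.
  by rewrite XP0 mul0mx mxE.
have [->|b1] /= := eqVneq b 1; first by rewrite mulr1.
have -> : b = 0 by case: b b1 => [[|[|[]]]] // lt _; apply: val_inj.
rewrite mulr0 -mulmxA; transitivity ((X *m col 0 (P *m Y^t*)) 1 0).
  by rewrite colE [in RHS]mulmxA -colE [RHS]mxE.
by rewrite PY0 mulmx0 mxE.
Qed.

(** If [Q] is invertible, [t] is an eigenvalue of [P *m invmx Q], which exists because the field is
    algebraically closed. *)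
Lemma singular_pencil n (P Q : 'M[C]_n.+1) :
  \det Q = 0 \/ exists t, \det (P - t *: Q) = 0.
Proof.
have [detQ|detQ] := eqVneq (\det Q) 0; [by left | right].
have unitQ : Q \in unitmx by rewrite unitmxE unitfE.
have [|t /rootP] := closed_rootP (char_poly (P *m invmx Q)) _.
  by rewrite size_char_poly.
rewrite -/(root _ _) => rt; exists t.
have /eigenvalueP [v ev v_neq0] : eigenvalue (P *m invmx Q) t.
  by rewrite eigenvalue_root_char; apply/rootP.
apply/eqP/det0P; exists v => //.
rewrite mulmxBr -[P](mulmxKV unitQ) !mulmxA -(mulmxA v P) ev.
by rewrite -scalemxAl -scalemxAr subrr.
Qed.

Lemma expi_surj (z : C) : z * z^* = 1 -> exists t, expi t = z.
Proof.
case: z => a b; rewrite /Num.conj /= => /eqP; rewrite eq_complex /=.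
rewrite mulrN opprK => /andP [/eqP ab1 _].
have aI : -1 <= a <= 1 by apply/andP; split; nra.
have cosa : cos (acos a) = a by rewrite acosK.
have sina : sin (acos a) = `|b|.
  by rewrite sin_acos // -ab1 expr2 addrC addKr -expr2 sqrtr_sqr.
(* The arc cosine fixes the sine only up to sign; the sign of [b] decides between the angle and its
   opposite. *)
case: (lerP 0 b) => b0; [exists (acos a)|exists (- acos a)];
  rewrite /expi ?cosN ?sinN cosa sina.
  by rewrite ger0_norm.
by rewrite ltr0_norm // opprK.
Qed.

End Matrices.

(** * Diagonalizing a unitary at one site *)

Section LME.
Variables (R : realType) (N : nat).
Local Notation C := R[i].

Lemma site_unitary d k (X : 'M[C]_d) :
  X \is unitarymx -> (site k X : 'M_(tdim N d)) \is unitarymx.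
Proof.
move=> unitX; apply: tensor_unitary => l; case: eqP => // _.
by apply/unitarymxP; rewrite trmx1 map_mx1 mulmx1.
Qed.

Lemma tdim_gt0 d : (0 < tdim N d.+1)%N.
Proof. by apply/card_gt0P; exists [ffun=> ord0]. Qed.

Lemma unitary_blocks d k (F : 'I_d -> 'I_d -> 'M[C]_(tdim N d)) :
  (forall a b, off_site k (F a b)) -> blocks k F \is unitarymx ->
  (forall a b, \sum_c F a c *m (F b c)^t* = (a == b)%:R%:M) /\
  (forall a b, \sum_c (F c a)^t* *m F c b = (a == b)%:R%:M).
Proof.
move=> cF unitF; have /unitarymxP FF := unitF.
have /mulmx1C F'F := FF.
have blocks1 : 1%:M = blocks k (fun a b => (a == b)%:R%:M) :> 'M[C]_(tdim N d).
  transitivity (site k (1%:M : 'M[C]_d) *m 1%:M); first by rewrite mulmx1 site1.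
  rewrite -blocks_site; congr blocks; apply/funext => a; apply/funext => b.
  by rewrite mxE scalemx1.
have cF' a b : off_site k ((F b a)^t*) by exact: off_site_adj.
have cI (a b : 'I_d) : off_site k ((a == b)%:R%:M : 'M[C]_(tdim N d)).
  by rewrite -scalemx1; apply/off_siteZ/off_site1.
rewrite blocks_adj // !blocks_mul // blocks1 in FF F'F.
split=> a b.
- apply: (blocks_inj _ cI FF) => {}a {}b.
  by apply: off_site_sum => c; apply: off_siteM.
- apply: (blocks_inj _ cI F'F) => {}a {}b.
  by apply: off_site_sum => c; apply: off_siteM.
Qed.

Lemma site_diagonal_corner (k : 'I_N) (s : C) (Q : 'M[C]_2) (A B : 'M[C]_(tdim N 2)) :
  off_site k A -> off_site k B ->
  site k (s *: delta_mx 1 1) *m A + site k Q *m B \is unitarymx ->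
  exists2 X : 'M[C]_2, X \is unitarymx &
    let T := site k X *m (site k (s *: delta_mx 1 1) *m A + site k Q *m B) in
    site k (delta_mx 0 0) *m T = T *m site k (delta_mx 0 0).
Proof.
move=> cA cB.
(* The corner term contributes only to block (1, 1), so the three other blocks are multiples of
   [B]. *)
pose D := s *: A + Q 1 1 *: B.
pose F (a b : 'I_2) := if (a == 1) && (b == 1) then D else Q a b *: B.
have cD : off_site k D by apply: off_siteD; apply: off_siteZ.
have cF a b : off_site k (F a b) by rewrite /F; case: ifP => // _; apply: off_siteZ.
have -> : site k (s *: delta_mx 1 1) *m A + site k Q *m B = blocks k F.
  rewrite -!blocks_site /blocks -big_split; apply: eq_bigr => a _.
  rewrite -big_split; apply: eq_bigr => b _ /=; rewrite -mulmxDr /F /D !mxE.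
  by case: (a =P 1) => [->|_]; case: (b =P 1) => [->|_];
    rewrite ?mulr1 ?mulr0 ?scale0r ?add0r.
move=> unitF; have [FF F'F] := unitary_blocks cF unitF.
have n_gt0 := tdim_gt0 1; pose i0 := Ordinal n_gt0.
(* The (0, 0) blocks of U^dagger U = 1 and U U^dagger = 1 involve only [B]: the first shows that [B]
   is a multiple of a unitary, and comparing the two gives |[Q 0 1]| = |[Q 1 0]|. *)
set c := Q 0 0 * (Q 0 0)^* + Q 1 0 * (Q 1 0)^*.
have adjZ (t : C) (M : 'M[C]_(tdim N 2)) : (t *: M)^t* = t^* *: M^t*.
  by rewrite linearZ /= map_mxZ.
have BB : c *: (B^t* *m B) = 1%:M.
  rewrite -(F'F 0 0) /F sum_ord2 /= !adjZ.
  by rewrite -!scalemxAl -!scalemxAr !scalerA -scalerDl /c; congr (_ *: _); ring.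
have BB' : c *: (B *m B^t*) = 1%:M.
  by rewrite scalemxAr; apply: mulmx1C; rewrite -scalemxAl.
have BB'' : (Q 0 0 * (Q 0 0)^* + Q 0 1 * (Q 0 1)^*) *: (B *m B^t*) = 1%:M.
  rewrite -(FF 0 0) /F sum_ord2 /= !adjZ.
  by rewrite -!scalemxAl -!scalemxAr !scalerA -scalerDl; congr (_ *: _); ring.
have scal_inj (t u : C) : t *: (1%:M : 'M[C]_(tdim N 2)) = u *: 1%:M -> t = u.
  by move/matrixP/(_ i0 i0); rewrite !mxE eqxx !mulr1.
have eqQ : Q 0 1 * (Q 0 1)^* = Q 1 0 * (Q 1 0)^*.
  apply: (addrI (Q 0 0 * (Q 0 0)^*)); rewrite -/c; apply: scal_inj.
  by rewrite -{1}BB' -BB'' !scalerA mulrC.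
(* If Q 1 0 != 0, the (0, 1) block of U^dagger U = 1 forces D = mu *: B. *)
have [Q10|Q10] := eqVneq (Q 1 0) 0.
  have Q01 : Q 0 1 = 0.
    by move/eqP: eqQ; rewrite Q10 mul0r mulf_eq0 conjC_eq0 orbb => /eqP.
  exists 1%:M; first by apply/unitarymxP; rewrite trmx1 map_mx1 mulmx1.
  rewrite /= site1 mul1mx /blocks !sum_ord2 /F /=.
  rewrite Q10 Q01 !scale0r !mulmx0 addr0 add0r mulmxDr mulmxDl !mulmxA -!siteM.
  rewrite -!mulmxA -cD -(off_siteZ _ cB) !mulmxA -!siteM.
  by rewrite !mul_delta_mx !mul_delta_mx_0.
set mu := - ((Q 0 0)^* * Q 0 1) / (Q 1 0)^*.
have Dmu : D = mu *: B.
  have E01 : ((Q 0 0)^* * Q 0 1) *: (B^t* *m B) + (Q 1 0)^* *: (B^t* *m D) = 0.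
    have := F'F 0 1; rewrite /F sum_ord2 /= !adjZ.
    by rewrite -!scalemxAl -scalemxAr scalerA raddf0.
  have /eqP : ((Q 0 0)^* * Q 0 1) *: B + (Q 1 0)^* *: D = 0.
    rewrite -[LHS]mul1mx -BB' -scalemxAl -mulmxA mulmxDr -!scalemxAr E01.
    by rewrite mulmx0 scaler0.
  rewrite addr_eq0 => /eqP E.
  have Q10J : (Q 1 0)^* != 0 by rewrite conjC_eq0.
  apply: (scalerI Q10J); rewrite scalerA -[LHS]opprK -E.
  by rewrite -scaleNr; congr (_ *: _); rewrite /mu; field.
(* Now all four blocks are multiples of [B], with coefficient matrix [w], so U = w (x) B. *)
pose w : 'M[C]_2 := \matrix_(a, b) if (a == 1) && (b == 1) then mu else Q a b.
have Fw : blocks k F = site k w *m B.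
  rewrite -blocks_site; congr blocks; apply/funext => a; apply/funext => b.
  by rewrite mxE /F; case: ifP => // _.
have ww : w^t* *m w = c%:M.
  apply: (site_inj_scalar n_gt0 (k := k)).
  have /unitarymxP/mulmx1C := unitF.
  rewrite Fw trmx_mul map_mxM -site_adj -mulmxA (mulmxA (site _ _)) -siteM cB.
  rewrite mulmxA => E.
  by rewrite -[LHS]mul1mx -BB -scalemxAl E scalemx1.
have c_ge0 : 0 <= c by rewrite addr_ge0 // mul_conjC_ge0.
have c_neq0 : c != 0.
  apply: contraTneq (oner_neq0 C) => c0; rewrite negbK; apply/eqP/esym.
  apply: scal_inj; by rewrite scale1r -BB c0 !scale0r.
pose r := sqrtC c; have rr : r * r = c by rewrite -expr2 sqrtCK.
have r_neq0 : r != 0 by rewrite sqrtC_eq0.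
have rJ : r^* = r by apply/conj_Creal/ger0_real; rewrite sqrtC_ge0.
(* Since [w^t* *m w] is the scalar [c], this is the inverse of the unitary part of [w]; applying it
   leaves a multiple of [B], which commutes with everything at site [k]. *)
exists (r^-1 *: w^t*).
  apply/unitarymxP; rewrite linearZ /= map_mxZ trmxCK fmorphV /= rJ.
  rewrite -scalemxAl -scalemxAr ww scalerA -scalemx1 scalerA -rr.
  by rewrite [X in X *: _](_ : _ = 1) ?scale1r //; field.
have sc : site k (c%:M : 'M_2) = c%:M.
  by rewrite -scalemx1 linearZ /= site1 scalemx1.
rewrite /= Fw linearZ /= -scalemxAl mulmxA -siteM ww sc mul_scalar_mx.
exact/off_siteZ/off_siteZ.
Qed.


(* Commuting with |0><0| at site k kills the entries <i|T|j> with i_k <> j_k. *)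
Definition diagonal_at (k : 'I_N) (T : 'M[C]_(tdim N 2)) :=
  site k (delta_mx 0 0) *m T = T *m site k (delta_mx 0 0).

Lemma site_diagonal (k : 'I_N) (P Q : 'M[C]_2) (A B : 'M[C]_(tdim N 2)) :
  off_site k A -> off_site k B -> site k P *m A + site k Q *m B \is unitarymx ->
  exists X Y : 'M[C]_2, [/\ X \is unitarymx, Y \is unitarymx &
    diagonal_at k (site k X *m (site k P *m A + site k Q *m B) *m site k Y)].
Proof.
(* If [Q] is singular, the two terms are swapped; otherwise a multiple of [Q] is subtracted from [P]
   and compensated by adding the same multiple of [A] to [B]. *)
wlog detP : P Q A B / \det P = 0 => [Hdet | cA cB unitU].
  move=> cA cB; have [detQ|[t detPQ]] := singular_pencil P Q.
    by rewrite addrC => unitU; apply: Hdet.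
  have -> : site k P *m A + site k Q *m B =
      site k (P - t *: Q) *m A + site k Q *m (B + t *: A).
    rewrite linearB linearZ /= mulmxBl mulmxDr -scalemxAl -scalemxAr.
    by rewrite [RHS]addrACA addNr addr0.
  apply: Hdet => //; exact/off_siteD/off_siteZ.
have [X [Y [s [unitX unitY XPY]]]] := singular_corner detP.
have eqU : site k X *m (site k P *m A + site k Q *m B) *m site k Y =
    site k (s *: delta_mx 1 1) *m A + site k (X *m Q *m Y) *m B.
  rewrite mulmxDr mulmxDl -XPY !siteM -!mulmxA.
  by rewrite -(cA Y) -(cB Y) !mulmxA.
have [|Z unitZ diagZ] := @site_diagonal_corner k s (X *m Q *m Y) A B cA cB.
  by rewrite -eqU !mul_unitarymx ?site_unitary.
exists (Z *m X), Y; split=> //; first exact: mul_unitarymx.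
by move: diagZ; rewrite /= -eqU /diagonal_at siteM -!mulmxA.
Qed.

(* The operator on one site whose vectorization is column r of V. *)
Definition site_factor m n (V : 'M[C]_(m * n, 2)) (r : 'I_2) : 'M[C]_(m, n) :=
  \matrix_(a, b) V (mxvec_index a b) r.

(** * Expansion of an LME unitary into product operators *)

Lemma site_pairs_inj (i j i' j' : label N 2) :
  site_pairs i j = site_pairs i' j' -> (i, j) = (i', j').
Proof.
move=> /ffunP eqs; have [g gK _] := curry_mxvec_bij 2 2.
have eqk k : (i k, j k) = (i' k, j' k).
  rewrite -[LHS]gK // -[RHS]gK //; congr g.
  by move: (eqs k); rewrite !ffunE.
by congr (_, _); apply/ffunP => k; case: (eqk k).
Qed.

Lemma vectorizationE (U : 'M[C]_(tdim N 2)) i j :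
  vectorization U (enum_rank (site_pairs i j)) 0 = entry U i j.
Proof.
rewrite /vectorization pair_big summxE (bigD1 (i, j)) //= big1 => [|[i' j'] /= neq].
  by rewrite addr0 !mxE !eqxx mulr1.
rewrite !mxE [_ == _]negbTE ?mulr0 //.
by apply: contra neq => /eqP/enum_rank_inj/site_pairs_inj ->.
Qed.

(** Undoing the vectorization turns each column of [V k] into an operator on site [k], so expanding
    [phi] in the product basis expands [U] in product operators. *)
Lemma LME_sum (U : 'M[C]_(tdim N 2)) (V : 'I_N -> 'M[C]_(2 * 2, 2))
    (phi : 'cV[C]_(tdim N 2)) :
  vectorization U = tensor V *m phi ->
  U = \sum_(s : label N 2)
        phi (enum_rank s) 0 *: tensor (fun k => site_factor (V k) (s k)).
Proof.
move=> vecU; apply/matrixP => p q.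
have := vectorizationE U (enum_val p) (enum_val q).
rewrite /entry !enum_valK => <-; rewrite vecU mxE summxE.
rewrite (reindex (enum_rank : label N 2 -> 'I_(tdim N 2))) /=; last first.
  by exists enum_val => x _; [exact: enum_rankK | exact: enum_valK].
apply: eq_bigr => s _; rewrite !mxE mulrC; congr (_ * _).
by apply: eq_bigr => k _; rewrite !mxE !enum_rankK ffunE.
Qed.

Lemma LME_site (U : 'M[C]_(tdim N 2)) (k : 'I_N) : admits_LME_state U ->
  exists (P Q : 'M[C]_2) A B,
    [/\ off_site k A, off_site k B & U = site k P *m A + site k Q *m B].
Proof.
move=> [V [phi [_ /LME_sum defU]]].
(* The terms are grouped by the digit of [s] at site [k], on which alone the factor at that site
   depends; each of the two groups shares one such factor. *)
pose A r := \sum_(s : label N 2 | s k == r) phi (enum_rank s) 0 *: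
  tensor (drop_site k (fun l => site_factor (V l) (s l))).
have cA r : off_site k (A r).
  by apply: off_site_sum => s; apply/off_siteZ/off_site_tensor.
exists (site_factor (V k) 0), (site_factor (V k) 1), (A 0), (A 1); split=> //.
rewrite -(sum_ord2 (fun r => site k (site_factor (V k) r) *m A r)).
rewrite {1}defU (partition_big (fun s : label N 2 => s k) predT) //=.
apply: eq_bigr => r _; rewrite mulmx_sumr; apply: eq_bigr => s /eqP <-.
by rewrite (tensor_site k) -scalemxAr.
Qed.

(** * From diagonality at every site to a phase unitary *)

Lemma site_delta_diag d k (a : 'I_d) : site k (delta_mx a a) =
  diag_mx (\row_(p < tdim N d) ((enum_val p : label N d) k == a)%:R) :> 'M[C]_(tdim N d).
Proof.
apply/matrixP => p q; rewrite siteE !mxE.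
have [<-|neq_pq] := eqVneq p q.
  by rewrite andbb big1 ?mulr1 // => l _; rewrite eqxx.
rewrite mulr0n; apply/eqP; apply: contraNT neq_pq.
rewrite mulf_eq0 negb_or pnatr_eq0 eqb0 negbK => /andP [/andP [/eqP pk /eqP qk]].
move/prodf_neq0 => eq_off; apply/eqP/enum_val_inj/ffunP => l.
have [->|lk] := eqVneq l k; first by rewrite pk qk.
by have := eq_off l lk; rewrite pnatr_eq0 eqb0 negbK => /eqP.
Qed.

Lemma diagonal_at_entry (T : 'M[C]_(tdim N 2)) :
  (forall k, diagonal_at k T) -> forall i j : label N 2, i != j -> entry T i j = 0.
Proof.
move=> diagT i j; apply: contraNeq => Tij; apply/eqP/ffunP => k.
(* Entrywise, commutation reads [[i k] = 0] T_ij = T_ij [[j k] = 0]. A nonzero T_ij thus forces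
   equal digits, there being only two values. *)
have := diagT k; rewrite /diagonal_at site_delta_diag mul_diag_mx mul_mx_diag.
move/matrixP/(_ (enum_rank i) (enum_rank j)); rewrite !mxE !enum_rankK mulrC.
move/(mulfI Tij)/eqP; rewrite eqr_nat.
by case: (i k) (j k) => [[|[|[]]] ?] // [[|[|[]]] ?] //= _; apply: val_inj.
Qed.

Lemma phase_unitaryE theta (i j : label N 2) :
  entry (phase_unitary theta) i j = (i == j)%:R * expi (theta i) :> C.
Proof.
rewrite /entry summxE (bigD1 i) //= big1 ?addr0 => [|l neq].
  rewrite !mxE big_ord1 !mxE !eqxx mul1r.
  by rewrite [_ == enum_rank i](inj_eq enum_rank_inj) eq_sym rmorph_nat mulrC andbT.
rewrite !mxE big_ord1 !mxE (inj_eq enum_rank_inj) eq_sym (negbTE neq) /=.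
by rewrite mul0r mulr0.
Qed.

Lemma diagonal_unitary_phase (T : 'M[C]_(tdim N 2)) :
  T \is unitarymx -> (forall i j : label N 2, i != j -> entry T i j = 0) ->
  exists theta, T = phase_unitary theta.
Proof.
move=> /unitarymxP TT diagT.
(* For diagonal [T], the (i, i) entry of T T^dagger = 1 says that T_ii has modulus one. *)
have /choice [theta def_theta] (i : label N 2) : exists t, expi t = entry T i i.
  apply: expi_surj; have := congr1 (fun M => entry M i i) TT.
  rewrite /entry !mxE eqxx (bigD1 (enum_rank i)) //= big1 ?addr0 ?mxE => [//|p].
  rewrite -[p]enum_valK (inj_eq enum_rank_inj) eq_sym => neq.
  by rewrite [T _ _](diagT _ _ neq) mul0r.
exists theta; apply/matrixP => p q; rewrite -[p]enum_valK -[q]enum_valK.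
rewrite -!/(entry _ _ _) phase_unitaryE def_theta.
by case: eqVneq => [->|/diagT->]; rewrite ?mul1r ?mul0r.
Qed.

End LME.

Theorem proposition22 (R : realType) (N : nat) (U : 'M[R[i]]_(tdim N 2))
    (unitaryU : U \is unitarymx) (lmeU : admits_LME_state U) :
  exists theta : label N 2 -> R, LU_equivalent U (phase_unitary theta).
Proof.
have /choice [XY XYP] (k : 'I_N) : exists XY : 'M[R[i]]_2 * 'M[R[i]]_2,
    [/\ XY.1 \is unitarymx, XY.2 \is unitarymx &
        diagonal_at k (site k XY.1 *m U *m site k XY.2)].
  have [P [Q [A [B [cA cB defU]]]]] := LME_site k lmeU.
  have [|X [Y [unitX unitY diagXY]]] := @site_diagonal _ _ k P Q A B cA cB.
    by rewrite -defU.
  by exists (X, Y); rewrite defU.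
(* The unitaries at each site are chosen independently, all from the original [U], and then applied
   together. *)
pose X k := (XY k).1; pose Y k := (XY k).2.
have unitX k : X k \is unitarymx by case: (XYP k).
have unitY k : Y k \is unitarymx by case: (XYP k).
have [theta defT] : exists theta, tensor X *m U *m tensor Y = phase_unitary theta.
  apply: diagonal_unitary_phase.
    by rewrite !mul_unitarymx ?tensor_unitary.
  apply: diagonal_at_entry => k; have [_ _ diagk] := XYP k.
  rewrite /diagonal_at (tensor_site k X) (tensor_site k Y).
  have cX := off_site_tensor k X; have cY := off_site_tensor k Y.
  set X' := tensor (drop_site k X) in cX *; set Y' := tensor (drop_site k Y) in cY *.
  (* The unitaries at the other sites commute with the projector at site [k], so moving them outside
     preserves diagonality there. *)
  have -> : site k (X k) *m X' *m U *m (site k (Y k) *m Y') =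
      X' *m (site k (X k) *m U *m site k (Y k)) *m Y' by rewrite cX -!mulmxA.
  rewrite -[RHS]mulmxA -cY 2!mulmxA cX -(mulmxA X') diagk.
  by rewrite !mulmxA.
by exists theta, X, Y; rewrite defT.
Qed.
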